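(* Let $\mathbb{F}$ be an algebraically closed field with $\mathrm{Char}(\mathbb{F})=2$, let $I$ denote the $2\times 2$ identity matrix, and let $A_{1,2}(\alpha_1,\alpha_2,\alpha_4,\beta_1),\dots,A_{12,2}$ be the $2$-dimensional algebras over $\mathbb{F}$ given by the matrices of structure constants listed in the context. Then, for all values of the parameters $\alpha_1,\alpha_2,\alpha_4,\beta_1,\beta_2\in\mathbb{F}$ (subject to the restrictions indicated), the automorphism groups are: \begin{itemize} \item $Aut(A_{1,2}(\alpha_1,\alpha_2,\alpha_4,\beta_1))=\{I\}$; \item $Aut(A_{2,2}(\alpha_1,\beta_1,\beta_2))=\{I\}$; \item $Aut(A_{3,2}(\alpha_1,\beta_2))=\left\{I,\begin{pmatrix}1&0\\1+\beta_2&1\end{pmatrix}\right\}$; \item $Aut(A_{4,2}(\alpha_1,\beta_2))=\left\{\begin{pmatrix}1&0\\0&d\end{pmatrix}: d\in\mathbb{F},\ d\neq 0\right\}$ if $\beta_2\neq 1$; \item $Aut(A_{4,2}(\alpha_1,1))=\left\{\begin{pmatrix}1&0\\c&d\end{pmatrix}: c,d\in\mathbb{F},\ d\neq 0\right\}$; \item $Aut(A_{5,2}(\alpha_1))=\left\{\begin{pmatrix}1&0\\c&1\end{pmatrix}: c\in\mathbb{F}\right\}$; \item $Aut(A_{6,2}(\alpha_1,\beta_1))=\{I\}$; \item $Aut(A_{7,2}(\alpha_1))=\left\{I,\begin{pmatrix}1&0\\1+\alpha_1&1\end{pmatrix}\right\}$; \item $Aut(A_{8,2}(\alpha_1))=\left\{\begin{pmatrix}1&0\\0&d\end{pmatrix}: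 d\in\mathbb{F},\ d\neq 0\right\}$ if $\alpha_1\neq 1$, and $Aut(A_{8,2}(1))=\left\{\begin{pmatrix}1&0\\c&d\end{pmatrix}: c,d\in\mathbb{F},\ d\neq 0\right\}$; \item $Aut(A_{9,2})=\left\{\begin{pmatrix}1&0\\c&1\end{pmatrix}: c\in\mathbb{F}\right\}$; \item $Aut(A_{10,2})=\left\{\begin{pmatrix}a&0\\0&1\end{pmatrix}: a\in\mathbb{F},\ a\neq 0\right\}$; \item $Aut(A_{11,2})=\left\{I,\begin{pmatrix}0&1\\1&0\end{pmatrix},\begin{pmatrix}0&1\\1&1\end{pmatrix},\begin{pmatrix}1&0\\1&1\end{pmatrix},\begin{pmatrix}1&1\\1&0\end{pmatrix},\begin{pmatrix}1&1\\0&1\end{pmatrix}\right\}$; \item $Aut(A_{12,2})=\left\{\begin{pmatrix}a&0\\c&a^2\end{pmatrix}: a,c\in\mathbb{F},\ a\neq 0\right\}$. \end{itemize}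
   Context: An algebra over $\mathbb{F}$ is a vector space with a bilinear multiplication (no associativity, commutativity or unit is assumed). A $2$-dimensional algebra $\mathbb{A}$ with fixed basis $e=(e^1,e^2)$ is identified with its matrix of structure constants (MSC) $A=\begin{pmatrix}\alpha_1&\alpha_2&\alpha_3&\alpha_4\\ \beta_1&\beta_2&\beta_3&\beta_4\end{pmatrix}\in M(2\times 4;\mathbb{F})$, meaning $\mathbf{u}\cdot\mathbf{v}=eA(u\otimes v)$ for $\mathbf{u}=eu$, $\mathbf{v}=ev$ with coordinate column vectors $u,v$. Explicitly, $e^1e^1=\alpha_1e^1+\beta_1e^2$, $e^1e^2=\alpha_2e^1+\beta_2e^2$, $e^2e^1=\alpha_3e^1+\beta_3e^2$, $e^2e^2=\alpha_4e^1+\beta_4e^2$. An automorphism is an invertible linear map $\mathbf{g}$ with $\mathbf{g}(\mathbf{u}\cdot\mathbf{v})=\mathbf{g}(\mathbf{u})\cdot\mathbf{g}(\mathbf{v})$; it is represented by the matrix $g\in GL(2;\mathbb{F})$ with $\mathbf{g}(eu)=egu$, so that $$Aut(A)=\{g\in GL(2;\mathbb{F}): gA-A(g\otimes g)=0\},$$ where for matrices $X=(x_{ij})$ and $Y$, $X\otimes Y$ is the block matrix with blocks $(x_{ij}Y)$. The algebras are (all parameters are arbitrary elements of $\mathbb{F}$): $A_{1,2}(\alpha_1,\alpha_2,\alpha_4,\beta_1)=\begin{pmatrix}\alpha_1&\alpha_2&\alpha_2+1&\alpha_4\\ \beta_1&-\alpha_1&-\alpha_1+1&-\alpha_2\end{pmatrix}$;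 $A_{2,2}(\alpha_1,\beta_1,\beta_2)=\begin{pmatrix}\alpha_1&0&0&1\\ \beta_1&\beta_2&1-\alpha_1&0\end{pmatrix}$; $A_{3,2}(\alpha_1,\beta_2)=\begin{pmatrix}\alpha_1&1&1&0\\ 0&\beta_2&1-\alpha_1&1\end{pmatrix}$; $A_{4,2}(\alpha_1,\beta_2)=\begin{pmatrix}\alpha_1&0&0&0\\ 0&\beta_2&1-\alpha_1&0\end{pmatrix}$; $A_{5,2}(\alpha_1)=\begin{pmatrix}\alpha_1&0&0&0\\ 1&1&1-\alpha_1&0\end{pmatrix}$; $A_{6,2}(\alpha_1,\beta_1)=\begin{pmatrix}\alpha_1&0&0&1\\ \beta_1&1-\alpha_1&-\alpha_1&0\end{pmatrix}$; $A_{7,2}(\alpha_1)=\begin{pmatrix}\alpha_1&1&1&0\\ 0&1-\alpha_1&-\alpha_1&-1\end{pmatrix}$; $A_{8,2}(\alpha_1)=\begin{pmatrix}\alpha_1&0&0&0\\ 0&1-\alpha_1&-\alpha_1&0\end{pmatrix}$; $A_{9,2}=\begin{pmatrix}1&0&0&0\\ 1&0&1&0\end{pmatrix}$; $A_{10,2}=\begin{pmatrix}0&1&1&0\\ 0&0&0&-1\end{pmatrix}$; $A_{11,2}=\begin{pmatrix}1&1&1&0\\ 0&-1&-1&-1\end{pmatrix}$; $A_{12,2}=\begin{pmatrix}0&0&0&0\\ 1&0&0&0\end{pmatrix}$. *)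

(* Defs.v *)
From HB Require Import structures.
From mathcomp Require Import all_boot all_order all_algebra.
From mathcomp Require Import mxtens.
From mathcomp Require Export classical_sets.

Set Implicit Arguments.
Unset Strict Implicit.
Unset Printing Implicit Defensive.

Import GRing.Theory.
Local Open Scope ring_scope.

Definition mx22 (F : fieldType) (a b c d : F) : 'M[F]_2 :=
  \matrix_(i < 2, j < 2) nth 0 (nth [::] [:: [:: a; b]; [:: c; d]] i) j.

(* The column index set is written 2 * 2 (convertible to 4) so that it matches
   the Kronecker product [*t] of mxtens, whose columns are ordered as
   e1 (x) e1, e1 (x) e2, e2 (x) e1, e2 (x) e2. *)
Definition MSC (F : fieldType) (a1 a2 a3 a4 b1 b2 b3 b4 : F) : 'M[F]_(2, 2 * 2) :=
  \matrix_(i < 2, j < 2 * 2)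
    nth 0 (nth [::] [:: [:: a1; a2; a3; a4]; [:: b1; b2; b3; b4]] i) j.

(* In coordinates with respect to the basis e, u . v = e A (u (x) v). *)
Definition alg_mul (F : fieldType) (A : 'M[F]_(2, 2 * 2)) (u v : 'cV[F]_2) :
  'cV[F]_2 := A *m (u *t v).

Definition Aut (F : fieldType) (A : 'M[F]_(2, 2 * 2)) : set 'M[F]_2 :=
  [set g | g \in unitmx /\ g *m A - A *m (g *t g) = 0]%classic.

Lemma alg_mulE (F : fieldType) (A : 'M[F]_(2, 2 * 2)) (i j : 'I_2) :
  alg_mul A (delta_mx i 0) (delta_mx j 0) = col (mxtens_index (i, j)) A.
Proof.
rewrite colE /alg_mul; congr (_ *m _); apply/matrixP => k l.
case: (mxtens_indexP k) => k1 k2.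
rewrite mxE mxtens_indexK !mxE /= !ord1 -natrM mulnb.
rewrite (can_eq (@mxtens_indexK 2 2)) xpair_eqE.
have e (x y : 'I_1) : (x == y) = true by rewrite !ord1 eqxx.
by rewrite !e !andbT.
Qed.

Lemma AutP (F : fieldType) (A : 'M[F]_(2, 2 * 2)) (g : 'M[F]_2) :
  Aut A g <->
  g \in unitmx /\
  forall u v : 'cV[F]_2, g *m alg_mul A u v = alg_mul A (g *m u) (g *m v).
Proof.
split=> -[gU gA]; split=> //.
  move=> u v; rewrite /alg_mul -tensmx_mul mulmxA [in RHS]mulmxA.
  by congr (_ *m _); apply/eqP; rewrite -subr_eq0 gA.
apply/eqP; rewrite subr_eq0; apply/eqP/matrixP => i k.
case: (mxtens_indexP k) => k1 k2.
have := gA (delta_mx k1 0) (delta_mx k2 0).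
rewrite alg_mulE /alg_mul -tensmx_mul mulmxA -/(alg_mul (A *m (g *t g)) _ _).
rewrite alg_mulE => /matrixP/(_ i 0); rewrite !mxE => <-.
by apply: eq_bigr => j _; rewrite !mxE.
Qed.

Section Algebras.
Variable F : fieldType.

Definition A1_2 (a1 a2 a4 b1 : F) :=
  MSC a1 a2 (a2 + 1) a4
      b1 (- a1) (- a1 + 1) (- a2).
Definition A2_2 (a1 b1 b2 : F) :=
  MSC a1 0 0 1
      b1 b2 (1 - a1) 0.
Definition A3_2 (a1 b2 : F) :=
  MSC a1 1 1 0
      0 b2 (1 - a1) 1.
Definition A4_2 (a1 b2 : F) :=
  MSC a1 0 0 0
      0 b2 (1 - a1) 0.
Definition A5_2 (a1 : F) :=
  MSC a1 0 0 0
      1 1 (1 - a1) 0.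
Definition A6_2 (a1 b1 : F) :=
  MSC a1 0 0 1
      b1 (1 - a1) (- a1) 0.
Definition A7_2 (a1 : F) :=
  MSC a1 1 1 0
      0 (1 - a1) (- a1) (- 1).
Definition A8_2 (a1 : F) :=
  MSC a1 0 0 0
      0 (1 - a1) (- a1) 0.
Definition A9_2 : 'M[F]_(2, 2 * 2) :=
  MSC 1 0 0 0
      1 0 1 0.
Definition A10_2 : 'M[F]_(2, 2 * 2) :=
  MSC 0 1 1 0
      0 0 0 (- 1).
Definition A11_2 : 'M[F]_(2, 2 * 2) :=
  MSC 1 1 1 0
      0 (- 1) (- 1) (- 1).
Definition A12_2 : 'M[F]_(2, 2 * 2) :=
  MSC 0 0 0 0
      1 0 0 0.
End Algebras.

(* Main.v *)
Require Import Defs.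
From mathcomp Require Import all_boot all_order all_algebra.
From mathcomp Require Import classical_sets.
From mathcomp Require Import mxtens ring.
Import GRing.Theory.
Local Open Scope classical_set_scope.
Local Open Scope ring_scope.

(** An invertible matrix g is an automorphism when eight polynomial equations
    in its entries hold, two for each product of basis vectors [Aut_MSCP]. What
    makes the system easy to solve is a pair of linear forms that every
    automorphism preserves: u |-> tr L_u and u |-> tr R_u, the traces of the
    left and right multiplications by u. Indeed g L_u g^-1 = L_(g u), so the
    two traces agree, and likewise on the right [Aut_traces].

    In the coordinates of the basis these forms are the rows
    (alpha_1 + beta_2, alpha_3 + beta_4) and
    (alpha_1 + beta_3, alpha_2 + beta_4). For A1 they are independent, so g is
    the identity. For A2 up to A9 one of them is (1, 0), which says exactly
    that the first row of g is (1, 0) [Aut_lower]: g e1 = e1 + c e2 and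
    g e2 = d e2. The products of basis vectors then determine c and d, and only
    four shapes of multiplication table occur, according to e2 e2 = e1,
    e2 e2 = e2, or e2 e2 = 0 with or without an e2 component in e1 e1.

    For A10, A11 and A12 both forms vanish and squares do the work instead.
    In characteristic 2 the algebra A11 is commutative and its squaring map
    sends x e1 + y e2 to x^2 e1 + y^2 e2, so an automorphism has entries in the
    field with two elements; conversely its nonzero idempotents are e1, e2 and
    e1 + e2, any two of them multiply to the third, and all of GL_2 over that
    field acts. *)

(** * Automorphisms in coordinates *)

(** Ideal membership by hand: when x - y is a combination of p - q for known
    equations p = q, one application per equation leaves a polynomial identity
    for [ring]. *)
Lemma lincomb {R : pzRingType} (k : R) {p q : R} (e : p = q) {x y : R} :
  x - k * p = y - k * q -> x = y.
Proof. by rewrite e => /addIr. Qed.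

Lemma mx22_ex {F : fieldType} (g : 'M[F]_2) :
  exists a b c d : F, g = mx22 a b c d.
Proof.
exists (g 0 0), (g 0 1), (g 1 0), (g 1 1).
apply/matrixP => i j; rewrite mxE.
by case: i => [[|[|]]] //= ?; case: j => [[|[|]]] //= ?; congr (g _ _);
  exact: val_inj.
Qed.

Lemma mx22_1 {F : fieldType} : mx22 1 0 0 1 = 1%:M :> 'M[F]_2.
Proof.
by apply/matrixP => i j; rewrite !mxE;
  case: i => [[|[|]]] //= ?; case: j => [[|[|]]].
Qed.

Lemma mx22_unit {F : fieldType} (a b c d : F) :
  (mx22 a b c d \in unitmx) = (a * d - b * c != 0).
Proof.
rewrite unitmxE unitfE (expand_det_row _ ord0) !big_ord_recl big_ord0.
rewrite /cofactor !det_mx11 !mxE /=.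
by congr (_ != 0); ring.
Qed.

Lemma Aut_1 {F : fieldType} (A : 'M[F]_(2, 2 * 2)) : Aut A 1%:M.
Proof. by apply/AutP; split=> [|u v]; rewrite ?unitmx1 ?mul1mx. Qed.

(** The four pairs compare the images of e1 e1, e1 e2, e2 e1 and e2 e2, in this
    order; in each pair come the e1 and then the e2 coordinates. *)
Lemma Aut_MSCP {F : fieldType} {a1 a2 a3 a4 b1 b2 b3 b4 a b c d : F} :
  Aut (MSC a1 a2 a3 a4 b1 b2 b3 b4) (mx22 a b c d) <->
  [/\ a * d - b * c <> 0
   ,  a * a1 + b * b1 = a1 * a ^+ 2 + (a2 + a3) * (a * c) + a4 * c ^+ 2 /\
      c * a1 + d * b1 = b1 * a ^+ 2 + (b2 + b3) * (a * c) + b4 * c ^+ 2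
   ,  a * a2 + b * b2
        = a1 * (a * b) + a2 * (a * d) + a3 * (b * c) + a4 * (c * d) /\
      c * a2 + d * b2
        = b1 * (a * b) + b2 * (a * d) + b3 * (b * c) + b4 * (c * d)
   ,  a * a3 + b * b3
        = a1 * (a * b) + a2 * (b * c) + a3 * (a * d) + a4 * (c * d) /\
      c * a3 + d * b3
        = b1 * (a * b) + b2 * (b * c) + b3 * (a * d) + b4 * (c * d)
   &  a * a4 + b * b4 = a1 * b ^+ 2 + (a2 + a3) * (b * d) + a4 * d ^+ 2 /\
      c * a4 + d * b4 = b1 * b ^+ 2 + (b2 + b3) * (b * d) + b4 * d ^+ 2].
Proof.
set M := MSC _ _ _ _ _ _ _ _; set g := mx22 _ _ _ _.
have AutE : Aut M g <-> a * d - b * c <> 0 /\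
    forall i k, (g *m M) i k = (M *m (g *t g)) i k.
  rewrite /Aut /= mx22_unit; split=> -[/eqP gU e]; split=> //.
    by move/eqP: e; rewrite subr_eq0 => /eqP ->.
  by apply/eqP; rewrite subr_eq0; apply/eqP/matrixP.
rewrite AutE; split.
- case=> gU e.
  (* At closed indices the entries of the Kronecker product compute. *)
  have E i (k : nat) (lt_k4 : (k < 2 * 2)%N) := e i (Ordinal lt_k4).
  move: (E 0 0 isT) (E 1 0 isT) (E 0 1 isT) (E 1 1 isT) => {e}.
  move: (E 0 2 isT) (E 1 2 isT) (E 0 3 isT) (E 1 3 isT) => {E}.
  rewrite !mxE !big_ord_recr !big_ord0 /= !mxE /= => e5 e6 e7 e8 e1 e2 e3 e4.
  split=> //; split;
    [apply: (lincomb 1 e1) | apply: (lincomb 1 e2) | apply: (lincomb 1 e3)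
    |apply: (lincomb 1 e4) | apply: (lincomb 1 e5) | apply: (lincomb 1 e6)
    |apply: (lincomb 1 e7) | apply: (lincomb 1 e8)]; ring.
- case=> gU e1 e2 e3 e4; split=> // i k.
  rewrite !mxE !big_ord_recr !big_ord0 /= !mxE /=.
  case: e1 e2 e3 e4 => e1 e2 [e3 e4] [e5 e6] [e7 e8].
  case: i => [[|[|]]] //= ?; case: k => [[|[|[|[|]]]]] //= ?;
    [apply: (lincomb 1 e1) | apply: (lincomb 1 e3) | apply: (lincomb 1 e5)
    |apply: (lincomb 1 e7) | apply: (lincomb 1 e2) | apply: (lincomb 1 e4)
    |apply: (lincomb 1 e6) | apply: (lincomb 1 e8)]; ring.
Qed.

(** * The invariant trace forms *)

(** Conjugation invariance of the trace: since g L_u = L_(g u) g, multiplying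
    by the adjugate of g and taking traces gives
    det g * tr L_u = det g * tr L_(g u), and the same holds for R_u. The
    coefficients +-a, ..., +-d in the proof are the entries of the adjugate. *)
Lemma Aut_traces {F : fieldType} {a1 a2 a3 a4 b1 b2 b3 b4 a b c d : F} :
  Aut (MSC a1 a2 a3 a4 b1 b2 b3 b4) (mx22 a b c d) ->
  [/\ (a1 + b2) * a + (a3 + b4) * c = a1 + b2
   ,  (a1 + b2) * b + (a3 + b4) * d = a3 + b4
   ,  (a1 + b3) * a + (a2 + b4) * c = a1 + b3
   &  (a1 + b3) * b + (a2 + b4) * d = a2 + b4].
Proof.
case/Aut_MSCP => /eqP gU [e1 e2] [e3 e4] [e5 e6] [e7 e8].
split; apply: (mulfI gU).
- apply: (lincomb (- d) e1); apply: (lincomb b e2).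
  apply: (lincomb c e3); apply: (lincomb (- a) e4); ring.
- apply: (lincomb (- d) e5); apply: (lincomb b e6).
  apply: (lincomb c e7); apply: (lincomb (- a) e8); ring.
- apply: (lincomb (- d) e1); apply: (lincomb b e2).
  apply: (lincomb c e5); apply: (lincomb (- a) e6); ring.
- apply: (lincomb (- d) e3); apply: (lincomb b e4).
  apply: (lincomb c e7); apply: (lincomb (- a) e8); ring.
Qed.

(** The hypothesis is that tr L or tr R is the first coordinate form; an
    automorphism preserving it has first row (1, 0). *)
Lemma Aut_lower {F : fieldType} {a1 a2 a3 a4 b1 b2 b3 b4 : F} {g} :
  a1 + b2 = 1 /\ a3 + b4 = 0 \/ a1 + b3 = 1 /\ a2 + b4 = 0 ->
  Aut (MSC a1 a2 a3 a4 b1 b2 b3 b4) g -> exists c d, g = mx22 1 0 c d.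
Proof.
have [a [b [c [d ->]]]] := mx22_ex g => trA /Aut_traces [].
case: trA => -[-> ->]; rewrite !mul1r !mul0r !addr0.
  by move=> -> -> _ _; exists c, d.
by move=> _ _ -> ->; exists c, d.
Qed.

(** What is left of the system once [Aut_lower] has fixed the first row: each
    table below has so many zeros that c and d can be read off. *)
Lemma Aut_lowerP {F : fieldType} {a1 a2 a3 a4 b1 b2 b3 b4 c d : F} :
  Aut (MSC a1 a2 a3 a4 b1 b2 b3 b4) (mx22 1 0 c d) <->
  [/\ d <> 0
   ,  c * (a2 + a3) + a4 * c ^+ 2 = 0 /\
      c * a1 + (d - 1) * b1 = (b2 + b3) * c + b4 * c ^+ 2
   ,  a2 * (1 - d) = a4 * (c * d) /\ c * a2 = b4 * (c * d)
   ,  a3 * (1 - d) = a4 * (c * d) /\ c * a3 = b4 * (c * d)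
   &  a4 * (d ^+ 2 - 1) = 0 /\ c * a4 = b4 * (d ^+ 2 - d)].
Proof.
rewrite Aut_MSCP mul1r mul0r subr0.
split=> -[? [e1 e2] [e3 e4] [e5 e6] [e7 e8]]; split=> //; split.
- apply: (lincomb (-1) e1); ring.
- apply: (lincomb 1 e2); ring.
- apply: (lincomb 1 e3); ring.
- apply: (lincomb 1 e4); ring.
- apply: (lincomb 1 e5); ring.
- apply: (lincomb 1 e6); ring.
- apply: (lincomb (-1) e7); ring.
- apply: (lincomb 1 e8); ring.
- apply: (lincomb (-1) e1); ring.
- apply: (lincomb 1 e2); ring.
- apply: (lincomb 1 e3); ring.
- apply: (lincomb 1 e4); ring.
- apply: (lincomb 1 e5); ring.
- apply: (lincomb 1 e6); ring.
- apply: (lincomb (-1) e7); ring.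
- apply: (lincomb 1 e8); ring.
Qed.

(** * Tables solved in every characteristic *)

(** The invariant forms are (0, 1) and (1, 0): together they are the two
    coordinates, so nothing can move. *)
Lemma Aut_A1_2 {F : fieldType} (a1 a2 a4 b1 : F) :
  Aut (A1_2 a1 a2 a4 b1) = [set 1%:M].
Proof.
apply/seteqP; split=> [g|_ ->]; last exact: Aut_1.
have [a [b [c [d ->]]]] := mx22_ex g.
move=> /Aut_traces[e1 e2 e3 e4] /=; rewrite -mx22_1.
have -> : a = 1 by apply: (lincomb 1 e3); ring.
have -> : b = 0 by apply: (lincomb 1 e4); ring.
have -> : c = 0 by apply: (lincomb 1 e1); ring.
by have -> : d = 1 by apply: (lincomb 1 e2); ring.
Qed.

(** Here e2 spans an ideal of square zero on which e1 acts by the scalars b2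
    and b3, so d is free; e1 + c e2 squares to a1 e1 + c (b2 + b3) e2, to be
    compared with a1 (e1 + c e2). *)
Lemma Aut_null_ideal {F : fieldType} (a1 b2 b3 : F) :
  a1 + b2 = 1 \/ a1 + b3 = 1 ->
  Aut (MSC a1 0 0 0 0 b2 b3 0) =
    [set g | exists c d, [/\ d <> 0, c * (a1 - b2 - b3) = 0
                           & g = mx22 1 0 c d]].
Proof.
move=> trA; apply/seteqP; split=> [g gA|_ [c [d [d0 e ->]]]]; last first.
  apply/Aut_lowerP; split=> //; split; try ring.
  by apply: (lincomb 1 e); ring.
have [|c [d eg]] := Aut_lower _ gA.
  by case: trA => ->; [left | right]; rewrite addr0.
move: gA; rewrite {}eg => /Aut_lowerP[d0 [_ e] _ _ _].
by exists c, d; split=> //; apply: (lincomb 1 e); ring.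
Qed.

Lemma Aut_null_ideal_neq0 {F : fieldType} (a1 b2 b3 : F) :
  a1 + b2 = 1 \/ a1 + b3 = 1 -> a1 - b2 - b3 <> 0 ->
  Aut (MSC a1 0 0 0 0 b2 b3 0) =
    [set g | exists d, d <> 0 /\ g = mx22 1 0 0 d].
Proof.
move=> trA /eqP nz; rewrite Aut_null_ideal //; apply/seteqP; split=> [g|g] /=.
  move=> [c [d [d0 /eqP + ->]]].
  by rewrite mulf_eq0 (negPf nz) orbF => /eqP ->; exists d.
by move=> [d [d0 ->]]; exists 0, d; rewrite mul0r.
Qed.

Lemma Aut_null_ideal_eq0 {F : fieldType} (a1 b2 b3 : F) :
  a1 + b2 = 1 \/ a1 + b3 = 1 -> a1 - b2 - b3 = 0 ->
  Aut (MSC a1 0 0 0 0 b2 b3 0) =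
    [set g | exists c d, d <> 0 /\ g = mx22 1 0 c d].
Proof.
move=> trA z; rewrite Aut_null_ideal // z; apply/seteqP; split=> [g|g] /=.
  by move=> [c [d [d0 _ ->]]]; exists c, d.
by move=> [c [d [d0 ->]]]; exists c, d; rewrite mulr0.
Qed.

(** As a1 = b2 + b3, the terms in c cancel from the square of e1 + c e2; what
    remains compares the e2 component 1 of e1 e1 with its image d. *)
Lemma Aut_null_ideal_shear {F : fieldType} (a1 b2 b3 : F) :
  a1 + b2 = 1 \/ a1 + b3 = 1 -> a1 - b2 - b3 = 0 ->
  Aut (MSC a1 0 0 0 1 b2 b3 0) = [set g | exists c, g = mx22 1 0 c 1].
Proof.
move=> trA z; apply/seteqP; split=> [g gA|_ [c ->]]; last first.
  apply/Aut_lowerP; split; first exact/eqP/oner_neq0; split; try ring.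
  by apply: (lincomb c z); ring.
have [|c [d eg]] := Aut_lower _ gA.
  by case: trA => ->; [left | right]; rewrite addr0.
move: gA; rewrite {}eg => /Aut_lowerP[d0 [_ e] _ _ _].
exists c; congr mx22; apply: (lincomb 1 e); apply: (lincomb (- c) z); ring.
Qed.

Lemma Aut_A9_2 {F : fieldType} :
  Aut (A9_2 F) = [set g | exists c, g = mx22 1 0 c 1].
Proof. by apply: Aut_null_ideal_shear; [left | ]; ring. Qed.

(** The only nonzero product is e1 e1 = e2, so g e2 = (g e1)^2 = a^2 e2. *)
Lemma Aut_A12_2 {F : fieldType} :
  Aut (A12_2 F) = [set g | exists a c, a <> 0 /\ g = mx22 a 0 c (a ^+ 2)].
Proof.
apply/seteqP; split=> [g|_ [a [c [/eqP a0 ->]]]]; last first.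
  apply/Aut_MSCP; split; [|split; ring..].
  by apply/eqP; rewrite mul0r subr0 !mulf_neq0.
have [a [b [c [d ->]]]] := mx22_ex g.
case/Aut_MSCP => gU [e1 e2] _ _ _.
have b0 : b = 0 by apply: (lincomb 1 e1); ring.
have d2 : d = a ^+ 2 by apply: (lincomb 1 e2); ring.
exists a, c; rewrite b0 d2; split=> // a0; apply: gU; rewrite b0 a0; ring.
Qed.

(** * Tables special to characteristic 2 *)

Section CharTwo.
Variable F : fieldType.
Hypothesis charF2 : 2%N \in [pchar F].

Let two0 : 1 + 1 = 0 :> F.
Proof. exact: addrr_pchar2. Qed.

Lemma sqr_eq1_char2 (d : F) : d ^+ 2 = 1 -> d = 1.
Proof.
move/eqP; rewrite sqrf_eq1 (oppr_pchar2 charF2) orbb; exact: eqP.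
Qed.

(** Since e2 e2 = e1, the image e1 + c e2 of e1 is (d e2)^2 = d^2 e1; thus
    c = 0 and d^2 = 1, whose only root in characteristic 2 is 1. *)
Lemma Aut_sqr_e2_e1 (a1 b1 b2 b3 : F) :
  a1 + b2 = 1 \/ a1 + b3 = 1 -> Aut (MSC a1 0 0 1 b1 b2 b3 0) = [set 1%:M].
Proof.
move=> trA; apply/seteqP; split=> [g gA|_ ->]; last exact: Aut_1.
have [|c [d eg]] := Aut_lower _ gA.
  by case: trA => ->; [left | right]; rewrite addr0.
move: gA; rewrite {}eg => /Aut_lowerP[_ _ _ _ [e1 e2]] /=; rewrite -mx22_1.
have -> : c = 0 by apply: (lincomb 1 e2); ring.
rewrite (@sqr_eq1_char2 d) //; apply: (lincomb 1 e1); ring.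
Qed.

Lemma Aut_A2_2 (a1 b1 b2 : F) : Aut (A2_2 a1 b1 b2) = [set 1%:M].
Proof. by apply: Aut_sqr_e2_e1; right; ring. Qed.

Lemma Aut_A6_2 (a1 b1 : F) : Aut (A6_2 a1 b1) = [set 1%:M].
Proof. by apply: Aut_sqr_e2_e1; left; ring. Qed.

(** Since e2 e2 = e2, d = 1. The square of e1 + c e2 then gives a quadratic
    equation for c, whose two roots are 0 and the displayed entry. The
    equation b4 = 1 lets the lemma cover both signs of 1 in that place. *)
Lemma Aut_sqr_e2_e2 (a1 b2 b3 b4 : F) :
  b4 = 1 -> a1 + b2 = 1 \/ a1 + b3 = 1 ->
  Aut (MSC a1 1 1 0 0 b2 b3 b4) = [set 1%:M; mx22 1 0 (a1 + b2 + b3) 1].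
Proof.
move=> -> trA; apply/seteqP; split=> [g gA|_ [->|->]]; last 2 first.
- exact: Aut_1.
- apply/Aut_lowerP; split; first exact/eqP/oner_neq0; split; try ring.
    by apply: (lincomb (a1 + b2 + b3) two0); ring.
  by apply: (lincomb (- (b2 + b3) * (a1 + b2 + b3)) two0); ring.
have [|c [d eg]] := Aut_lower _ gA.
  by case: trA => ->; [left | right]; rewrite two0.
move: gA; rewrite {}eg.
move=> /Aut_lowerP[/eqP d_neq0 [_ e1] [e2 _] _ _] /=; rewrite -mx22_1.
have {e2}-> : d = 1 by apply: (lincomb (-1) e2); ring.
have: c * (c - (a1 + b2 + b3)) = 0.
  by apply: (lincomb (-1) e1); apply: (lincomb (- (b2 + b3) * c) two0); ring.
move/eqP; rewrite mulf_eq0 subr_eq0.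
by case/orP=> /eqP ->; [left | right].
Qed.

Lemma Aut_A3_2 (a1 b2 : F) :
  Aut (A3_2 a1 b2) = [set 1%:M; mx22 1 0 (1 + b2) 1].
Proof.
rewrite /A3_2 Aut_sqr_e2_e2 //; last by right; ring.
by rewrite (_ : a1 + b2 + (1 - a1) = 1 + b2) //; ring.
Qed.

Lemma Aut_A7_2 (a1 : F) : Aut (A7_2 a1) = [set 1%:M; mx22 1 0 (1 + a1) 1].
Proof.
rewrite /A7_2 Aut_sqr_e2_e2; [|exact: oppr_pchar2|by left; ring].
rewrite (_ : a1 + (1 - a1) + - a1 = 1 + a1) //.
by apply: (lincomb (- a1) two0); ring.
Qed.

Lemma Aut_A4_2_neq1 (a1 b2 : F) : b2 <> 1 ->
  Aut (A4_2 a1 b2) = [set g | exists d, d <> 0 /\ g = mx22 1 0 0 d].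
Proof.
move=> b2_neq1; apply: Aut_null_ideal_neq0; first by right; ring.
move=> e; apply: b2_neq1; apply: (lincomb (-1) e).
by apply: (lincomb (a1 - 1) two0); ring.
Qed.

Lemma Aut_A4_2_1 (a1 : F) :
  Aut (A4_2 a1 1) = [set g | exists c d, d <> 0 /\ g = mx22 1 0 c d].
Proof.
apply: Aut_null_ideal_eq0; first by right; ring.
by apply: (lincomb (a1 - 1) two0); ring.
Qed.

Lemma Aut_A8_2_neq1 (a1 : F) : a1 <> 1 ->
  Aut (A8_2 a1) = [set g | exists d, d <> 0 /\ g = mx22 1 0 0 d].
Proof.
move=> a1_neq1; apply: Aut_null_ideal_neq0; first by left; ring.
move=> e; apply: a1_neq1; apply: (lincomb 1 e).
by apply: (lincomb (- a1) two0); ring.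
Qed.

Lemma Aut_A8_2_1 :
  Aut (A8_2 (1 : F)) = [set g | exists c d, d <> 0 /\ g = mx22 1 0 c d].
Proof.
apply: Aut_null_ideal_eq0; first by left; ring.
by apply: (lincomb 1 two0); ring.
Qed.

Lemma Aut_A5_2 (a1 : F) :
  Aut (A5_2 a1) = [set g | exists c, g = mx22 1 0 c 1].
Proof.
apply: Aut_null_ideal_shear; first by right; ring.
by apply: (lincomb (a1 - 1) two0); ring.
Qed.

(** The vectors of square zero form the line of e1, and e2 e2 = e2 up to
    sign; so c = 0, and squaring g e2 gives b = 0 and d = 1. *)
Lemma Aut_A10_2 :
  Aut (A10_2 F) = [set g | exists a, a <> 0 /\ g = mx22 a 0 0 1].
Proof.
apply/seteqP; split=> [g|_ [a [a0 ->]]]; last first.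
  by apply/Aut_MSCP; rewrite mulr1 mul0r subr0; split=> //; split; ring.
have [a [b [c [d ->]]]] := mx22_ex g.
case/Aut_MSCP => gU [_ e1] _ _ [e2 e3].
have c0 : c = 0.
  have /eqP: c ^+ 2 = 0 by apply: (lincomb 1 e1); ring.
  by rewrite expf_eq0 => /eqP.
move: gU; rewrite {}c0 in e1 e3 *.
rewrite mulr0 subr0 => /eqP; rewrite mulf_eq0 negb_or => /andP[/eqP a0 d0].
have b0 : b = 0.
  by apply: (lincomb (-1) e2); apply: (lincomb (- (b * d)) two0); ring.
have d1 : d = 1.
  apply: (mulfI d0); apply: (lincomb 1 e3); rewrite b0; ring.
by exists a; rewrite b0 d1.
Qed.

(** Each entry x of an automorphism satisfies x^2 = x because squaring acts
    on coordinates by Frobenius; of the sixteen matrices with entries 0 and 1,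
    six are invertible. *)
Lemma Aut_A11_2 :
  Aut (A11_2 F) =
    [set 1%:M; mx22 0 1 1 0; mx22 0 1 1 1; mx22 1 0 1 1; mx22 1 1 1 0;
         mx22 1 1 0 1].
Proof.
have [opp2 add2] := (oppr_pchar2 charF2, addrr_pchar2 charF2).
have simp2 := (opp2, add2, mul0r, mulr0, mul1r, mulr1, add0r, addr0, expr0n,
  expr1n).
apply/seteqP; split=> g; last first.
  have one0 : 1 <> 0 :> F by apply/eqP/oner_neq0.
  rewrite /= -mx22_1.
  by move=> [[[[[->|->]|->]|->]|->]|->]; apply/Aut_MSCP; rewrite !simp2.
have [a [b [c [d ->]]]] := mx22_ex g.
case/Aut_MSCP => gU [e1 e2] _ _ [e3 e4].
have bool_of (x : F) : x ^+ 2 = x -> x = 0 \/ x = 1.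
  move=> e; have /eqP: x * (x - 1) = 0 by apply: (lincomb 1 e); ring.
  by rewrite mulf_eq0 subr_eq0 => /orP[]/eqP; [left | right].
have /bool_of ea : a ^+ 2 = a.
  by apply: (lincomb (-1) e1); apply: (lincomb (- (a * c)) two0); ring.
have /bool_of eb : b ^+ 2 = b.
  by apply: (lincomb 1 e3); apply: (lincomb (b ^+ 2 + b * d) two0); ring.
have /bool_of ec : c ^+ 2 = c.
  by apply: (lincomb (-1) e2); apply: (lincomb (c ^+ 2 + a * c) two0); ring.
have /bool_of ed : d ^+ 2 = d.
  by apply: (lincomb 1 e4); apply: (lincomb (- (b * d)) two0); ring.
move: gU; rewrite /= -mx22_1.
case: ea => ->; case: eb => ->; case: ec => ->; case: ed => ->;
  by rewrite ?simp2 ?subrr //; tauto.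
Qed.

End CharTwo.

(** * The automorphism groups *)

Theorem theorem3p2 (F : closedFieldType) (charF2 : 2%N \in [pchar F]) :
  (forall a1 a2 a4 b1 : F, Aut (A1_2 a1 a2 a4 b1) = [set 1%:M]) /\
  (forall a1 b1 b2 : F, Aut (A2_2 a1 b1 b2) = [set 1%:M]) /\
  (forall a1 b2 : F,
    Aut (A3_2 a1 b2) = [set 1%:M; mx22 1 0 (1 + b2) 1]) /\
  (forall a1 b2 : F, b2 <> 1 ->
    Aut (A4_2 a1 b2) =
      [set g | exists d : F, d <> 0 /\ g = mx22 1 0 0 d]) /\
  (forall a1 : F,
    Aut (A4_2 a1 1) =
      [set g | exists c d : F, d <> 0 /\ g = mx22 1 0 c d]) /\
  (forall a1 : F,
    Aut (A5_2 a1) = [set g | exists c : F, g = mx22 1 0 c 1]) /\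
  (forall a1 b1 : F, Aut (A6_2 a1 b1) = [set 1%:M]) /\
  (forall a1 : F,
    Aut (A7_2 a1) = [set 1%:M; mx22 1 0 (1 + a1) 1]) /\
  (forall a1 : F, a1 <> 1 ->
    Aut (A8_2 a1) =
      [set g | exists d : F, d <> 0 /\ g = mx22 1 0 0 d]) /\
  Aut (A8_2 (1 : F)) =
    [set g | exists c d : F, d <> 0 /\ g = mx22 1 0 c d] /\
  Aut (A9_2 F) = [set g | exists c : F, g = mx22 1 0 c 1] /\
  Aut (A10_2 F) = [set g | exists a : F, a <> 0 /\ g = mx22 a 0 0 1] /\
  Aut (A11_2 F) =
    [set 1%:M; mx22 0 1 1 0; mx22 0 1 1 1; mx22 1 0 1 1; mx22 1 1 1 0;
         mx22 1 1 0 1] /\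
  Aut (A12_2 F) =
    [set g | exists a c : F, a <> 0 /\ g = mx22 a 0 c (a ^+ 2)].
Proof.
split; first exact: Aut_A1_2.
split; first exact: Aut_A2_2.
split; first exact: Aut_A3_2.
split; first exact: Aut_A4_2_neq1.
split; first exact: Aut_A4_2_1.
split; first exact: Aut_A5_2.
split; first exact: Aut_A6_2.
split; first exact: Aut_A7_2.
split; first exact: Aut_A8_2_neq1.
split; first exact: Aut_A8_2_1.
split; first exact: Aut_A9_2.
split; first exact: Aut_A10_2.
by split; [exact: Aut_A11_2 | exact: Aut_A12_2].
Qed.
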